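(* Let $B\subseteq K$ be compact Hausdorff spaces, let $f\colon K\to\mathbb{R}^n$ be continuous and let $r>0$. Put $X:=|f|^{-1}[0,r]$ and $A:=|f|^{-1}(r)$, and let $\phi_f\in H^n(X,A)$ be the first obstruction of $f$. Then for each $k\ge n$, the group $$\phi_f\frown H_k(X,A\cup B):=\{\phi_f\frown\beta : \beta\in H_k(X,A\cup B)\}\subseteq H_{k-n}(X,B)$$ is a subgroup of the well group $U_{k-n}(f,r)$.
   Context: Fix a norm $|\cdot|$ on $\mathbb{R}^n$; $|f|$ denotes the function $x\mapsto|f(x)|$, and $\|f-g\|:=\max_{x\in K}|f(x)-g(x)|$. For $Y\subseteq K$, the pair $(Y,Y\cap B)$ is abbreviated $(Y,B)$, so $H_*(Y,B)$ means $H_*(Y,Y\cap B)$, and $H_*(X,A\cup B)$ means $H_*(X,A\cup(B\cap X))$. All (co)homology has coefficients in $\mathbb{Z}$. Homology theory: $H_*$ is a homology theory on compact Hausdorff pairs satisfying the Eilenberg–Steenrod axioms, with the possible exception of the exactness axiom, and in addition: (1) weak continuity: for every decreasing sequence of compact pairs $(X_0,B_0)\supset(X_1,B_1)\supset\cdots$ the inclusion-induced homomorphism $H_*(\bigcap_i X_i,\bigcap_i B_i)\to\varprojlim H_*(X_i,B_i)$ is surjective; (2) strong excision: if a map of compact pairs $(X,X')\to(Y,Y')$ maps $X\setminus X'$ homeomorphically onto $Y\setminus Y'$, then it induces an isomorphism $H_*(X,X')\to H_*(Y,Y')$. Čech homology is such a theory. $H^*$ is a cohomology theory satisfying the Eilenberg–Steenrod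 axioms, paired with $H_*$ by a cap product $H^n(X,A)\otimes H_k(X,A\cup B)\xrightarrow{\frown}H_{k-n}(X,B)$ that is natural (i.e. $f_*(f^*(\alpha)\frown\beta)=\alpha\frown f_*(\beta)$) and coincides with the simplicial cap product on simplicial complexes (e.g. Čech cohomology with the Čech cap product). Well group: let $Z_r(f):=\{g^{-1}(0) : g\colon K\to\mathbb{R}^n\text{ continuous},\ \|f-g\|\le r\}$. All these zero sets lie in $X$. The $j$th well group is $$U_j(f,r):=\bigcap_{Z\in Z_r(f)}\mathrm{Im}\big(H_j(Z,B)\xrightarrow{i_*}H_j(X,B)\big),$$ where $i_*$ is induced by the inclusion $Z\hookrightarrow X$. First obstruction: view $f$ as a map of pairs $(X,A)\to(B^n,S^{n-1})$, where $S^{n-1}=\{x\in\mathbb{R}^n:|x|=r\}$ and $B^n$ is the ball bounded by it. Then $\phi_f:=f^*(\xi)\in H^n(X,A)$ with $\xi\in H^n(B^n,S^{n-1})$ the fundamental cohomology class. *)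

(* Defs.v *)
From HB Require Import structures.
From mathcomp Require Import all_boot all_order all_algebra.
From mathcomp Require Import all_classical all_reals all_analysis.

Set Implicit Arguments.
Unset Strict Implicit.
Unset Printing Implicit Defensive.

Import Order.TTheory GRing.Theory Num.Theory.
Import numFieldNormedType.Exports.

Local Open Scope classical_set_scope.
Local Open Scope ring_scope.

Record compHaus := CompHaus {
  ch_space :> topologicalType;
  ch_compact : compact [set: ch_space];
  ch_hausdorff : hausdorff_space ch_space }.

Record cpair := CPair {
  tot :> compHaus;
  sub : set tot;
  sub_closed : closed sub }.

Arguments sub : clear implicits.

Record cmap (P Q : cpair) := CMap {
  cmap_fun :> P -> Q;
  cmap_continuous : continuous cmap_fun;
  cmap_sub : forall x : P, sub P x -> sub Q (cmap_fun x) }.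

Lemma id_continuous (T : topologicalType) : continuous (@idfun T).
Proof. by move=> x. Qed.

Definition cmap_id (P : cpair) : cmap P P :=
  @CMap P P idfun (@id_continuous P) (fun=> id).

Lemma comp_continuous (S T U : topologicalType) (f : S -> T) (g : T -> U) :
  continuous f -> continuous g -> continuous (g \o f).
Proof. by move=> cf cg x; apply: continuous_comp; [exact: cf|exact: cg]. Qed.

Definition cmap_comp (P Q S : cpair) (g : cmap Q S) (f : cmap P Q) : cmap P S :=
  @CMap P S (g \o f)
    (comp_continuous (@cmap_continuous _ _ f) (@cmap_continuous _ _ g))
    (fun x px => cmap_sub g (cmap_sub f px)).

Lemma set_val_continuous (T : topologicalType) (Y : set T) :
  continuous (set_val : set_type Y -> T).
Proof. exact: initial_continuous. Qed.

Lemma compact_set_type (T : topologicalType) (Y : set T) :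
  compact Y -> compact [set: set_type Y].
Proof.
move=> cY F FF _.
have FY : (set_val @ F) Y.
  by rewrite /nbhs /=; apply: filterS filterT => -[x xY] _; exact: set_mem.
have [y [Yy cly]] := cY (set_val @ F) _ FY.
exists (exist _ y (mem_set Yy)); split=> // A U FA [V [[W oW <-] Wy] VU].
have FA' : (set_val @ F) (set_val @` A).
  by rewrite /nbhs /=; apply: filterS FA => a Aa; exists a.
have nW : nbhs y W by apply: open_nbhs_nbhs; split.
have [_ [[a Aa <-] Wa]] := cly _ _ FA' nW.
by exists a; split=> //; exact: VU.
Qed.

Lemma hausdorff_set_type (T : topologicalType) (Y : set T) :
  hausdorff_space T -> hausdorff_space (set_type Y).
Proof.
move=> hT p q pq; apply: val_inj; apply: hT => A B nA nB.
have [z [Az Bz]] := pq _ _ (set_val_continuous nA) (set_val_continuous nB).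
by exists (set_val z); split.
Qed.

Lemma closed_set_type (T : topologicalType) (Y B : set T) :
  closed B -> closed ((set_val : set_type Y -> T) @^-1` B).
Proof.
by move=> cB; apply: preimage_closed => // x _; exact: set_val_continuous.
Qed.

Definition subspace_ch (T : topologicalType) (hT : hausdorff_space T)
    (Y : set T) (hY : compact Y) : compHaus :=
  @CompHaus (set_type Y) (compact_set_type hY) (hausdorff_set_type hT).

(* [(Y, Y `&` B)], abbreviated [(Y, B)] *)
Definition subpair (T : topologicalType) (hT : hausdorff_space T)
    (Y B : set T) (hY : compact Y) (hB : closed B) : cpair :=
  @CPair (subspace_ch hT hY) _ (closed_set_type hB).

Definition corestrict (S T : Type) (Y : set T) (g : S -> T)
    (gY : forall x, Y (g x)) (x : S) : set_type Y :=
  exist _ (g x) (mem_set (gY x)).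

Lemma corestrict_continuous (S T : topologicalType) (Y : set T) (g : S -> T)
    (gY : forall x, Y (g x)) :
  continuous g -> continuous (corestrict gY).
Proof.
by move=> cg; exact: (@continuous_comp_initial _ _ _ set_val (corestrict gY)).
Qed.

Lemma set_valK (T : Type) (Y : set T) (x : set_type Y) : Y (set_val x).
Proof. by case: x => x xY; exact: set_mem. Qed.

Section Inclusions.
Variables (T : topologicalType) (hT : hausdorff_space T).
Variables (Y Y' B B' : set T) (hY : compact Y) (hY' : compact Y').
Variables (hB : closed B) (hB' : closed B').
Hypotheses (YY' : Y `<=` Y') (BB' : B `<=` B').

Let f_in (x : set_type Y) : Y' (set_val x) := YY' (set_valK x).

Definition subpair_incl : cmap (subpair hT hY hB) (subpair hT hY' hB') :=
  @CMap (subpair hT hY hB) (subpair hT hY' hB') (corestrict f_in)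
    (corestrict_continuous (gY := f_in) (@set_val_continuous T Y))
    (fun x => BB' (t := set_val x)).

End Inclusions.

Definition incl_tot (P : cpair) (Y B : set P) (hY : compact Y) (hB : closed B)
    (BP : B `<=` sub P) : cmap (subpair (@ch_hausdorff P) hY hB) P :=
  @CMap (subpair (@ch_hausdorff P) hY hB) P set_val
    (@set_val_continuous P Y) (fun x => BP (set_val x)).

Lemma closed_compact (P : compHaus) (Y : set P) : closed Y -> compact Y.
Proof. by move=> cY; apply: subclosed_compact (@ch_compact P) _. Qed.

Definition tot_pair (P : cpair) : cpair := @CPair P set0 (@closed0 P).

Definition sub_pair (P : cpair) : cpair :=
  subpair (@ch_hausdorff P) (closed_compact (@sub_closed P)) (@closed0 P).

Definition sub_to_tot (P : cpair) : cmap (sub_pair P) (tot_pair P) :=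
  @CMap (sub_pair P) (tot_pair P) set_val
    (@set_val_continuous P (sub P)) (fun=> id).

Definition tot_to_pair (P : cpair) : cmap (tot_pair P) P :=
  @CMap (tot_pair P) P idfun (@id_continuous P) (fun x => @False_ind _).

Section SubMap.
Variables (P Q : cpair) (f : cmap P Q).

Let f_in (x : sub_pair P) : sub Q (f (set_val x)) :=
  cmap_sub f (set_valK (Y := sub P) x).

Definition sub_map : cmap (sub_pair P) (sub_pair Q) :=
  @CMap (sub_pair P) (sub_pair Q) (corestrict f_in)
    (corestrict_continuous (gY := f_in)
       (comp_continuous (@set_val_continuous P (sub P)) (@cmap_continuous _ _ f)))
    (fun=> id).

End SubMap.

Definition homotopic (R : realType) (P Q : cpair) (f g : cmap P Q) : Prop :=
  exists F : P * R -> Q,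
    [/\ {within [set: P] `*` `[0, 1], continuous F},
        forall x, F (x, 0) = f x,
        forall x, F (x, 1) = g x &
        forall x t, sub P x -> 0 <= t <= 1 -> sub Q (F (x, t))].

Section ExcisionPair.
Variables (P : cpair) (U : set P) (oU : open U).

Definition excised : cpair :=
  subpair (@ch_hausdorff P) (closed_compact (open_closedC oU)) (@sub_closed P).

Definition excision_incl : cmap excised P :=
  incl_tot (closed_compact (open_closedC oU)) (@sub_closed P) (@subset_refl _ _).

End ExcisionPair.

Definition one_point (P : cpair) : Prop :=
  (exists x : P, forall y : P, y = x) /\ sub P = set0.

(* The Eilenberg-Steenrod axioms on compact Hausdorff pairs, except exactness;
   as in Eilenberg and Steenrod, degrees are arbitrary integers. *)
Record homology (R : realType) := Homology {
  hgrp :> int -> cpair -> zmodType;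
  hmap : forall (q : int) (P Q : cpair),
    cmap P Q -> {additive hgrp q P -> hgrp q Q};
  hbd : forall (q : int) (P : cpair),
    {additive hgrp q P -> hgrp (q - 1) (sub_pair P)};
  hmap_id : forall (q : int) (P : cpair) (x : hgrp q P),
    hmap q (cmap_id P) x = x;
  hmap_comp : forall (q : int) (P Q S : cpair) (g : cmap Q S) (f : cmap P Q)
    (x : hgrp q P),
    hmap q (cmap_comp g f) x = hmap q g (hmap q f x);
  hbd_natural : forall (q : int) (P Q : cpair) (f : cmap P Q) (x : hgrp q P),
    hbd q Q (hmap q f x) =
    hmap (q - 1) (sub_map f) (hbd q P x);
  hmap_homotopy : forall (q : int) (P Q : cpair) (f g : cmap P Q),
    homotopic R f g -> forall x : hgrp q P, hmap q f x = hmap q g x;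
  hmap_excision : forall (q : int) (P : cpair) (U : set P) (oU : open U),
    closure U `<=` interior (sub P) ->
    bijective (hmap q (excision_incl oU));
  hgrp_point : forall P : cpair, one_point P ->
    (exists e : {additive hgrp 0 P -> int}, bijective e) /\
    (forall q : int, q != 0 -> forall x : hgrp q P, x = 0) }.

Record cohomology (R : realType) := Cohomology {
  cgrp :> int -> cpair -> zmodType;
  comap : forall (q : int) (P Q : cpair),
    cmap P Q -> {additive cgrp q Q -> cgrp q P};
  cobd : forall (q : int) (P : cpair),
    {additive cgrp q (sub_pair P) -> cgrp (q + 1) P};
  comap_id : forall (q : int) (P : cpair) (x : cgrp q P),
    comap q (cmap_id P) x = x;
  comap_comp : forall (q : int) (P Q S : cpair) (g : cmap Q S) (f : cmap P Q)
    (x : cgrp q S),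
    comap q (cmap_comp g f) x = comap q f (comap q g x);
  cobd_natural : forall (q : int) (P Q : cpair) (f : cmap P Q)
    (x : cgrp q (sub_pair Q)),
    comap (q + 1) f (cobd q Q x) =
    cobd q P (comap q (sub_map f) x);
  exact_tot : forall (q : int) (P : cpair) (x : cgrp q (tot_pair P)),
    comap q (sub_to_tot P) x = 0 <->
    exists y : cgrp q P, comap q (tot_to_pair P) y = x;
  exact_sub : forall (q : int) (P : cpair) (x : cgrp q (sub_pair P)),
    cobd q P x = 0 <->
    exists y : cgrp q (tot_pair P),
      comap q (sub_to_tot P) y = x;
  exact_pair : forall (q : int) (P : cpair) (x : cgrp (q + 1) P),
    comap (q + 1) (tot_to_pair P) x = 0 <->
    exists y : cgrp q (sub_pair P), cobd q P y = x;
  comap_homotopy : forall (q : int) (P Q : cpair) (f g : cmap P Q),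
    homotopic R f g -> forall x : cgrp q Q, comap q f x = comap q g x;
  comap_excision : forall (q : int) (P : cpair) (U : set P) (oU : open U),
    closure U `<=` interior (sub P) ->
    bijective (comap q (excision_incl oU));
  cgrp_point : forall P : cpair, one_point P ->
    (exists e : {additive cgrp 0 P -> int}, bijective e) /\
    (forall q : int, q != 0 -> forall x : cgrp q P, x = 0) }.

Arguments hmap {R} h {q P Q} f.
Arguments hbd {R} h {q} P.
Arguments comap {R} c {q P Q} f.
Arguments cobd {R} c {q} P.

Lemma bigcap_compact (T : topologicalType) (hT : hausdorff_space T)
    (Y : nat -> set T) :
  (forall i, compact (Y i)) -> compact (\bigcap_i Y i).
Proof.
move=> cY; apply: subclosed_compact (cY 0%N) _.
  by apply: closed_bigI => i _; exact: compact_closed.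
by move=> x; exact.
Qed.

Lemma bigcap_closed (T : topologicalType) (B : nat -> set T) :
  (forall i, closed (B i)) -> closed (\bigcap_i B i).
Proof. by move=> cB; exact: closed_bigI. Qed.

Lemma bigcap_sub (T : Type) (B : nat -> set T) (i : nat) :
  \bigcap_i B i `<=` B i.
Proof. by move=> x; exact. Qed.

(* An element of the inverse limit is a family [x i] compatible with the
   inclusions. *)
Definition weakly_continuous (R : realType) (H : homology R) : Prop :=
  forall (T : topologicalType) (hT : hausdorff_space T) (Y B : nat -> set T)
    (hY : forall i, compact (Y i)) (hB : forall i, closed (B i))
    (dY : forall i, Y i.+1 `<=` Y i) (dB : forall i, B i.+1 `<=` B i),
    (forall i, B i `<=` Y i) ->
  forall (q : int) (x : forall i, H q (subpair hT (hY i) (hB i))),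
    (forall i, hmap H (subpair_incl hT (hY i.+1) (hY i) (hB i.+1) (hB i)
                         (dY i) (dB i)) (x i.+1) = x i) ->
  exists y : H q (subpair hT (bigcap_compact hT hY) (bigcap_closed hB)),
    forall i, hmap H (subpair_incl hT (bigcap_compact hT hY) (hY i)
                        (bigcap_closed hB) (hB i)
                        (@bigcap_sub _ Y i) (@bigcap_sub _ B i)) y = x i.

(* [f] maps [C] homeomorphically onto [D]; the last clause says that the
   bijection [C -> D] is open for the subspace topologies. *)
Definition maps_homeo (S T : topologicalType) (f : S -> T)
    (C : set S) (D : set T) : Prop :=
  [/\ set_bij C D f, {within C, continuous f} &
      forall U, open U -> exists2 V, open V & f @` (C `&` U) = D `&` V].

Definition strong_excision (R : realType) (H : homology R) : Prop :=
  forall (P Q : cpair) (f : cmap P Q), maps_homeo f (~` sub P) (~` sub Q) ->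
  forall q : int, bijective (hmap H f : H q P -> H q Q).

Record cap_product (R : realType) (H : homology R) (C : cohomology R) := Cap {
  cap_op : forall (n k : int) (X : compHaus) (A B : set X)
    (hA : closed A) (hB : closed B),
    C n (CPair hA) -> H k (CPair (closedU hA hB)) -> H (k - n) (CPair hB);
  capBl : forall (n k : int) (X : compHaus) (A B : set X)
    (hA : closed A) (hB : closed B)
    (a a' : C n (CPair hA)) (b : H k (CPair (closedU hA hB))),
    cap_op (a - a') b =
    cap_op a b - cap_op a' b;
  capBr : forall (n k : int) (X : compHaus) (A B : set X)
    (hA : closed A) (hB : closed B)
    (a : C n (CPair hA)) (b b' : H k (CPair (closedU hA hB))),
    cap_op a (b - b') =
    cap_op a b - cap_op a b';
  (* [fA], [fB] and [fAB] are one map [X -> Y] seen as a map of three pairs *)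
  cap_natural : forall (n k : int) (X Y : compHaus)
    (A B : set X) (A' B' : set Y)
    (hA : closed A) (hB : closed B) (hA' : closed A') (hB' : closed B')
    (fA : cmap (CPair hA) (CPair hA')) (fB : cmap (CPair hB) (CPair hB'))
    (fAB : cmap (CPair (closedU hA hB)) (CPair (closedU hA' hB'))),
    (forall x : X, fA x = fB x) -> (forall x : X, fAB x = fB x) ->
    forall (a : C n (CPair hA')) (b : H k (CPair (closedU hA hB))),
    hmap H fB (cap_op (comap C fA a) b) =
    cap_op a (hmap H fAB b) }.

Arguments cap_op {R H C} c {n k X A B hA hB} _ _.

Record complex (N : nat) := Complex {
  faces : {set {set 'I_N}};
  faces_neq0 : finset.set0 \notin faces;
  faces_down : forall s t : {set 'I_N},
    s \in faces -> t \subset s -> t != finset.set0 -> t \in faces }.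

Definition subcomplex (N : nat) (L S : complex N) : bool :=
  faces L \subset faces S.

Lemma empty_neq0 N : finset.set0 \notin (finset.set0 : {set {set 'I_N}}).
Proof. by rewrite finset.inE. Qed.

Lemma empty_down N (s t : {set 'I_N}) :
  s \in (finset.set0 : {set {set 'I_N}}) -> t \subset s -> t != finset.set0 ->
  t \in (finset.set0 : {set {set 'I_N}}).
Proof. by rewrite finset.inE. Qed.

Definition empty_complex N : complex N := Complex (empty_neq0 N) (@empty_down N).

Lemma union_neq0 N (L M : complex N) :
  finset.set0 \notin finset.setU (faces L) (faces M).
Proof.
by rewrite finset.in_setU negb_or (faces_neq0 L) (faces_neq0 M).
Qed.

Lemma union_down N (L M : complex N) (s t : {set 'I_N}) :
  s \in finset.setU (faces L) (faces M) -> t \subset s -> t != finset.set0 ->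
  t \in finset.setU (faces L) (faces M).
Proof.
rewrite !finset.in_setU => /orP[] sL ts t0; apply/orP.
  by left; exact: faces_down sL ts t0.
by right; exact: faces_down sL ts t0.
Qed.

Definition union_complex N (L M : complex N) : complex N :=
  Complex (union_neq0 L M) (@union_down N L M).

(* Ordered chain complex: a [k]-simplex is a sequence of [k.+1] vertices,
   possibly with repetitions, that span a face. *)
Definition osimp (N k : nat) : finType := {ffun 'I_k.+1 -> 'I_N}.

Definition vertices N k (s : osimp N k) : {set 'I_N} :=
  finset.finset [pred v | [exists i, s i == v]].

Definition face N k (i : 'I_k.+2) (s : osimp N k.+1) : osimp N k :=
  [ffun j => s (lift i j)].

Definition front N n k (s : osimp N k) : osimp N n := [ffun j : 'I_n.+1 => s (inord j)].

Definition back N n k (s : osimp N k) : osimp N (k - n)%N :=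
  [ffun j : 'I_(k - n).+1 => s (inord (n + j)%N)].

Definition vmap N M k (v : 'I_N -> 'I_M) (s : osimp N k) : osimp M k :=
  [ffun j => v (s j)].

Definition chain (N k : nat) : zmodType := {ffun osimp N k -> int}.

Definition chain_bd N k (c : chain N k.+1) : chain N k :=
  [ffun s => \sum_(t : osimp N k.+1) \sum_(i < k.+2 | face i t == s)
     (-1) ^+ i * c t].

Definition cochain_cobd N k (a : chain N k) : chain N k.+1 :=
  [ffun t => \sum_(i < k.+2) (-1) ^+ i * a (face i t)].

Definition chain_push N M k (v : 'I_N -> 'I_M) (c : chain N k) : chain M k :=
  [ffun s => \sum_(t : osimp N k | vmap v t == s) c t].

Definition cochain_pull N M k (v : 'I_N -> 'I_M) (a : chain M k) : chain N k :=
  [ffun t => a (vmap v t)].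

(* [a] cap [v_0, .., v_k] = a [v_0, .., v_n] * [v_n, .., v_k] *)
Definition chain_cap N n k (a : chain N n) (c : chain N k) : chain N (k - n)%N :=
  [ffun s => \sum_(t : osimp N k | back n t == s) a (front n t) * c t].

Definition chain_in N (S : complex N) k (c : chain N k) : Prop :=
  forall s, c s != 0 -> vertices s \in faces S.

Definition cycle_rel N (S L : complex N) k : chain N k -> Prop :=
  match k return chain N k -> Prop with
  | 0%N => fun c => chain_in S c
  | k'.+1 => fun c => chain_in S c /\ chain_in L (chain_bd c)
  end.

Definition boundary_rel N (S L : complex N) k (c : chain N k) : Prop :=
  chain_in S c /\
  exists2 e : chain N k.+1, chain_in S e & chain_in L (c - chain_bd e).

(* A cochain of [(S, L)] vanishes on [L]; its values on vertex sequences that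
   do not span a face of [S] are irrelevant. *)
Definition cochain_rel N (L : complex N) k (a : chain N k) : Prop :=
  forall s, vertices s \in faces L -> a s = 0.

Definition eq_on N (S : complex N) k (a b : chain N k) : Prop :=
  forall s, vertices s \in faces S -> a s = b s.

Definition cocycle_rel N (S L : complex N) k (a : chain N k) : Prop :=
  cochain_rel L a /\ eq_on S (cochain_cobd a) 0.

Definition coboundary_rel N (S L : complex N) k : chain N k -> Prop :=
  match k return chain N k -> Prop with
  | 0%N => fun a => eq_on S a 0
  | k'.+1 => fun a => exists2 b : chain N k',
      cochain_rel L b & eq_on S a (cochain_cobd b)
  end.

Definition realization (R : realType) N (S : complex N) : set 'rV[R]_N :=
  [set x | [/\ forall i, 0 <= x ord0 i, \sum_i x ord0 i = 1 &
      finset.finset [pred i | x ord0 i != 0] \in faces S]].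

Lemma rV_hausdorff (R : realType) n : hausdorff_space 'rV[R]_n.
Proof. exact: norm_hausdorff. Qed.

Lemma realization_closed (R : realType) N (S : complex N) :
  closed (@realization R N S).
Proof.
have coord i : continuous (fun x : 'rV[R]_N => x ord0 i).
  exact: coord_continuous.
pose F (s : {set 'I_N}) : set 'rV[R]_N :=
  [set x : 'rV[R]_N | \sum_i x ord0 i = 1] `&`
  (\bigcap_i [set x : 'rV[R]_N | 0 <= x ord0 i]) `&`
  (\bigcap_(i in [set i | i \notin s]) [set x : 'rV[R]_N | x ord0 i = 0]).
have cF s : closed (F s).
  apply: closedI; first apply: closedI.
  - apply: (@preimage_closed _ _ (fun x : 'rV[R]_N => \sum_i x ord0 i) [set 1]).
      move=> x _; apply: continuous_big; last by move=> i _; exact: coord.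
      exact: add_continuous.
    exact: closed_eq.
  - apply: closed_bigI => i _.
    apply: (@preimage_closed _ _ (fun x : 'rV[R]_N => x ord0 i) [set y | 0 <= y]).
      by move=> x _; exact: coord.
    exact: closed_ge.
  - apply: closed_bigI => i _.
    apply: (@preimage_closed _ _ (fun x : 'rV[R]_N => x ord0 i) [set 0]).
      by move=> x _; exact: coord.
    exact: closed_eq.
suff -> : @realization R N S = \bigcup_(s in [set s | s \in faces S]) F s.
  by apply: closed_bigcup => [|s _]; [exact: finite_finset|exact: cF].
apply/seteqP; split=> x /=.
  move=> [x0 x1 xS]; exists (finset.finset [pred i | x ord0 i != 0]) => //.
  split; first by split=> // i _; exact: x0.
  by move=> i /=; rewrite finset.inE /= negbK => /eqP.
move=> [s sS [[x1 x0] xs]]; split=> //; first by move=> i; exact: x0.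
apply: (faces_down sS).
  apply/fintype.subsetP => i; rewrite finset.inE /=; apply: contraNT => iS.
  by apply/eqP; exact: xs.
apply/eqP => e; move: x1 => /=; rewrite big1 => [/esym/eqP|i _].
  by rewrite oner_eq0.
by apply/eqP; apply: contraT => xi; have := finset.in_set0 i;
  rewrite -e finset.inE /= xi.
Qed.

Lemma realization_compact (R : realType) N (S : complex N) :
  compact (@realization R N S).
Proof.
apply: bounded_closed_compact; last exact: realization_closed.
exists 1; split; first exact: real1.
move=> M M1 x [x0 x1 _] /=; rewrite /Num.norm /= mx_normrE.
apply/bigmax_leP; split=> [|[i j] _ /=]; first exact: le_trans (ltW M1).
rewrite (ord1 i) ger0_norm// (le_trans _ (ltW M1))// -x1 (bigD1 j)//= lerDl.
exact: sumr_ge0.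
Qed.

Definition geom (R : realType) N (S L : complex N) : cpair :=
  subpair (@rV_hausdorff R N) (@realization_compact R N S)
    (@realization_closed R N L).

Definition simplicial N M (v : 'I_N -> 'I_M) (S : complex N) (S' : complex M) :
    Prop :=
  forall s, s \in faces S -> finset.imset v (mem s) \in faces S'.

(* [h] is the map affine on simplices induced by the vertex map [v] *)
Definition realizes (R : realType) N M (v : 'I_N -> 'I_M)
    (S L : complex N) (S' L' : complex M)
    (h : cmap (geom R S L) (geom R S' L')) : Prop :=
  forall (x : geom R S L) j,
    (set_val (h x) : 'rV[R]_M) ord0 j =
    \sum_(i < N | v i == j) (set_val x : 'rV[R]_N) ord0 i.

(* The equation [q = k%:Z] is a parameter so that the degrees [q - 1], [q + 1]
   and [q - p] of the axioms need no transport. *)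
Definition hom_comparison (R : realType) (H : homology R) : Type :=
  forall (q : int) (k : nat), q = k%:Z ->
  forall (N : nat) (S L : complex N), chain N k -> H q (geom R S L).

Definition coh_comparison (R : realType) (C : cohomology R) : Type :=
  forall (q : int) (k : nat), q = k%:Z ->
  forall (N : nat) (S L : complex N), chain N k -> C q (geom R S L).

(* [eta] induces isomorphisms from the simplicial homology groups
   [cycle_rel / boundary_rel], natural for simplicial maps and commuting with
   the boundary operators.  In the last clause [i] identifies the copy of
   [realization L] inside [realization S] with [realization L]. *)
Definition is_hom_comparison (R : realType) (H : homology R)
    (eta : hom_comparison H) : Prop :=
  [/\ forall q k (e : q = k%:Z) N (S L : complex N) (c c' : chain N k),
        subcomplex L S -> cycle_rel S L c -> cycle_rel S L c' ->
        eta q k e N S L (c - c') = eta q k e N S L c - eta q k e N S L c',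
      forall q k (e : q = k%:Z) N (S L : complex N) (x : H q (geom R S L)),
        subcomplex L S -> exists2 c, cycle_rel S L c & eta q k e N S L c = x,
      forall q k (e : q = k%:Z) N (S L : complex N) (c : chain N k),
        subcomplex L S -> cycle_rel S L c ->
        (eta q k e N S L c = 0 <-> boundary_rel S L c),
      forall q k (e : q = k%:Z) N M (v : 'I_N -> 'I_M)
        (S L : complex N) (S' L' : complex M)
        (h : cmap (geom R S L) (geom R S' L')) (c : chain N k),
        subcomplex L S -> subcomplex L' S' ->
        simplicial v S S' -> simplicial v L L' -> realizes v h ->
        cycle_rel S L c ->
        hmap H h (eta q k e N S L c) = eta q k e M S' L' (chain_push v c) &
      forall q k (e : q = k.+1%:Z) (e' : q - 1 = k%:Z) N (S L : complex N)
        (i : cmap (sub_pair (geom R S L)) (geom R L (empty_complex N)))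
        (c : chain N k.+1),
        subcomplex L S ->
        (forall x, set_val (i x) = set_val (set_val x) :> 'rV[R]_N) ->
        cycle_rel S L c ->
        hmap H i (hbd H _ (eta q k.+1 e N S L c)) =
        eta (q - 1) k e' N L (empty_complex N) (chain_bd c)].

Definition is_coh_comparison (R : realType) (C : cohomology R)
    (theta : coh_comparison C) : Prop :=
  [/\ forall q k (e : q = k%:Z) N (S L : complex N) (a a' : chain N k),
        subcomplex L S -> cocycle_rel S L a -> cocycle_rel S L a' ->
        theta q k e N S L (a - a') =
        theta q k e N S L a - theta q k e N S L a',
      forall q k (e : q = k%:Z) N (S L : complex N) (x : C q (geom R S L)),
        subcomplex L S -> exists2 a, cocycle_rel S L a & theta q k e N S L a = x,
      forall q k (e : q = k%:Z) N (S L : complex N) (a : chain N k),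
        subcomplex L S -> cocycle_rel S L a ->
        (theta q k e N S L a = 0 <-> coboundary_rel S L a),
      forall q k (e : q = k%:Z) N M (v : 'I_N -> 'I_M)
        (S L : complex N) (S' L' : complex M)
        (h : cmap (geom R S L) (geom R S' L')) (a : chain M k),
        subcomplex L S -> subcomplex L' S' ->
        simplicial v S S' -> simplicial v L L' -> realizes v h ->
        cocycle_rel S' L' a ->
        comap C h (theta q k e M S' L' a) =
        theta q k e N S L (cochain_pull v a) &
      forall q k (e : q = k%:Z) (e' : q + 1 = k.+1%:Z) N (S L : complex N)
        (i : cmap (sub_pair (geom R S L)) (geom R L (empty_complex N)))
        (a : chain N k),
        subcomplex L S ->
        (forall x, set_val (i x) = set_val (set_val x) :> 'rV[R]_N) ->
        cocycle_rel L (empty_complex N) a ->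
        cobd C _ (comap C i (theta q k e N L (empty_complex N) a)) =
        theta (q + 1) k.+1 e' N S L (cochain_cobd a)].

(* [j] is the identity: the realization of the union of two complexes equals
   the union of their realizations, but not by conversion. *)
Definition simplicial_cap (R : realType) (H : homology R) (C : cohomology R)
    (cp : cap_product H C) : Prop :=
  exists (eta : hom_comparison H) (theta : coh_comparison C),
  [/\ is_hom_comparison eta, is_coh_comparison theta &
  forall (p q : int) (n k : nat) (ep : p = n%:Z) (eq : q = k%:Z)
    (e : q - p = (k - n)%N%:Z) (N : nat) (S L1 L2 : complex N)
    (j : cmap (geom R S (union_complex L1 L2))
       (CPair (closedU (@sub_closed (geom R S L1)) (@sub_closed (geom R S L2)))))
    (a : chain N n) (c : chain N k),
    (n <= k)%N -> subcomplex L1 S -> subcomplex L2 S -> (forall x, j x = x) ->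
    cocycle_rel S L1 a -> cycle_rel S (union_complex L1 L2) c ->
    cap_op cp (theta p n ep N S L1 a)
      (hmap H j (eta q k eq N S (union_complex L1 L2) c)) =
    eta (q - p) (k - n)%N e N S L2 (chain_cap a c)].

Record vnorm (R : realType) (n : nat) := VNorm {
  vnorm_fun :> 'rV[R]_n -> R;
  vnorm_eq0 : forall x, vnorm_fun x = 0 -> x = 0;
  vnormZ : forall (a : R) x, vnorm_fun (a *: x) = `|a| * vnorm_fun x;
  vnormD : forall x y, vnorm_fun (x + y) <= vnorm_fun x + vnorm_fun y }.

Section VNormTheory.
Variables (R : realType) (n : nat) (N : vnorm R n).

Lemma vnorm0 : N 0 = 0.
Proof. by rewrite -(scale0r 0) vnormZ normr0 mul0r. Qed.

Lemma vnormN x : N (- x) = N x.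
Proof. by rewrite -scaleN1r vnormZ normrN1 mul1r. Qed.

Lemma vnorm_ge0 x : 0 <= N x.
Proof.
have := vnormD N x (- x); rewrite subrr vnorm0 vnormN -mulr2n.
by rewrite pmulrn_lge0.
Qed.

Lemma vnorm_sum (I : finType) (F : I -> 'rV[R]_n) :
  N (\sum_i F i) <= \sum_i N (F i).
Proof.
elim/big_rec2 : _ => [|i y x _ h]; first by rewrite vnorm0.
by rewrite (le_trans (vnormD N _ _))// lerD2l.
Qed.

Lemma vnorm_le_norm : exists2 M : R, 0 < M & forall x, N x <= M * `|x|.
Proof.
exists (1 + \sum_(i < n) N (delta_mx ord0 i)).
  by rewrite ltr_wpDr// sumr_ge0// => i _; exact: vnorm_ge0.
move=> x; rewrite {1}(row_sum_delta x) (le_trans (vnorm_sum _))//.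
rewrite mulrDl mul1r mulr_suml ler_wpDl// ler_sum// => i _.
rewrite vnormZ mulrC ler_wpM2l ?vnorm_ge0//.
rewrite [leRHS]/Num.norm /= mx_normrE.
by apply/bigmax_geP; right => /=; exists (ord0, i).
Qed.

Lemma vnorm_continuous : continuous (N : 'rV[R]_n -> R).
Proof.
have [M M0 NM] := vnorm_le_norm.
have h (x y : 'rV[R]_n) : `|N x - N y| <= M * `|x - y|.
  apply: (le_trans _ (NM _)); rewrite ler_norml; apply/andP; split.
    by rewrite lerNl opprB lerBlDr -(vnormN (x - y)) opprB
      (le_trans _ (vnormD _ _ _))// subrK.
  by rewrite lerBlDr (le_trans _ (vnormD _ _ _))// subrK.
move=> x; apply/(@cvgrPdist_le _ _ _ (nbhs x) _ N (N x)) => e e0.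
near=> y; rewrite (le_trans (h _ _))// -ler_pdivlMl//.
near: y; apply/nbhs_ballP; exists (M^-1 * e) => /=.
  by rewrite mulr_gt0// invr_gt0.
by move=> y; rewrite -ball_normE => /ltW.
Unshelve. all: by end_near. Qed.

Lemma norm_le_vnorm : exists2 M : R, 0 < M & forall x, `|x| <= M * N x.
Proof.
pose S := [set x : 'rV[R]_n | `|x| = 1].
have cS : compact S.
  apply: bounded_closed_compact.
    exists 1; split; first exact: real1.
    by move=> M M1 x /= ->; exact: ltW.
  apply: (@preimage_closed _ _ (fun x : 'rV[R]_n => `|x|) [set 1]).
    by move=> x _; exact: norm_continuous.
  exact: closed_eq.
have [S0|/set0P/negP] := pselect (S !=set0); last first.
  rewrite negbK => /eqP S0; exists 1 => // x; rewrite mul1r.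
  have [->|x0] := eqVneq x 0; first by rewrite normr0 vnorm_ge0.
  have : S (`|x|^-1 *: x).
    by rewrite /S /= normrZ normfV normr_id mulVf// normr_eq0.
  by rewrite S0.
have [|c cS' cmin] := compact_EVT_min S0 cS (f := N).
  by apply: continuous_subspaceT => x; exact: vnorm_continuous.
have Nc0 : 0 < N c.
  rewrite lt_neqAle vnorm_ge0 andbT eq_sym; apply/eqP => /vnorm_eq0 c0.
  by move: cS'; rewrite inE /S /= c0 normr0 => /eqP; rewrite eq_sym oner_eq0.
exists (N c)^-1; first by rewrite invr_gt0.
move=> x; have [->|x0] := eqVneq x 0.
  by rewrite normr0 mulr_ge0 ?vnorm_ge0// invr_ge0 ltW.
have xS : `|x|^-1 *: x \in S.
  by rewrite inE /S /= normrZ normfV normr_id mulVf// normr_eq0.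
have := cmin _ xS; rewrite vnormZ normfV normr_id.
rewrite ler_pdivlMl ?normr_gt0// => h.
by rewrite mulrC ler_pdivlMr.
Qed.

End VNormTheory.

Section WellGroup.
Variables (R : realType) (n : nat) (N : vnorm R n).

Definition sublevel (T : Type) (f : T -> 'rV[R]_n) (r : R) : set T :=
  [set x | N (f x) <= r].

Definition level (T : Type) (f : T -> 'rV[R]_n) (r : R) : set T :=
  [set x | N (f x) = r].

Lemma vnorm_comp_continuous (T : topologicalType) (f : T -> 'rV[R]_n) :
  continuous f -> continuous (fun x => N (f x)).
Proof. by move=> cf; apply: comp_continuous cf _; exact: vnorm_continuous. Qed.

Lemma sublevel_closed (T : topologicalType) (f : T -> 'rV[R]_n) (r : R) :
  continuous f -> closed (sublevel f r).
Proof.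
move=> cf; apply: (@preimage_closed _ _ (fun x => N (f x)) [set y | y <= r]).
  by move=> x _; exact: vnorm_comp_continuous.
exact: closed_le.
Qed.

Lemma level_closed (T : topologicalType) (f : T -> 'rV[R]_n) (r : R) :
  continuous f -> closed (level f r).
Proof.
move=> cf; apply: (@preimage_closed _ _ (fun x => N (f x)) [set r]).
  by move=> x _; exact: vnorm_comp_continuous.
exact: closed_eq.
Qed.

Arguments sublevel_closed {T f} r hf : rename.
Arguments level_closed {T f} r hf : rename.

Lemma ball_compact (r : R) : compact (sublevel idfun r).
Proof.
apply: bounded_closed_compact; last exact/sublevel_closed/id_continuous.
have [M M0 h] := norm_le_vnorm N.
exists (M * r); split; first exact: num_real.
move=> M' rM x xr /=; rewrite (le_trans (h _))// (le_trans _ (ltW rM))//.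
by rewrite ler_wpM2l// ltW.
Qed.

Definition ball_pair (r : R) : cpair :=
  subpair (@rV_hausdorff R n) (@ball_compact r)
    (level_closed r (@id_continuous 'rV[R]_n)).

(* The fundamental class is determined up to sign: it is a generator of the
   infinite cyclic group [C n (ball_pair r)]. *)
Definition fundamental (C : cohomology R) (r : R) (xi : C n%:Z (ball_pair r)) :
    Prop :=
  forall a, exists! m : int, a = xi *~ m.

Variable K : compHaus.

(* The supremum is a maximum when [f], [g] are continuous and [K] is nonempty;
   it is [0] when [K] is empty. *)
Definition dist (f g : K -> 'rV[R]_n) : R :=
  sup [set N (f x - g x) | x in [set: K]].

Lemma dist_ub (f g : K -> 'rV[R]_n) (x : K) :
  continuous f -> continuous g -> N (f x - g x) <= dist f g.
Proof.
move=> cf cg; apply: ub_le_sup; last by exists x.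
have cfg : continuous (fun x => N (f x - g x)).
  apply: (@vnorm_comp_continuous _ (fun x => f x - g x)) => y.
  by apply: cvgB; [exact: cf|exact: cg].
have [|c _ cmax] := compact_EVT_max _ (@ch_compact K) (continuous_subspaceT cfg).
  by exists x.
by exists (N (f c - g c)) => _ [y _ <-]; apply: cmax; rewrite inE.
Qed.

Definition zero_sets (f : K -> 'rV[R]_n) (r : R) : set (set K) :=
  [set Z | exists g : K -> 'rV[R]_n,
     [/\ continuous g, dist f g <= r & Z = g @^-1` [set 0]]].

Lemma zero_set_compact (f : K -> 'rV[R]_n) (r : R) (Z : set K) :
  zero_sets f r Z -> compact Z.
Proof.
move=> [g [cg _ ->]]; apply: closed_compact; apply: preimage_closed.
  by move=> x _; exact: cg.
exact/accessible_closed_set1/hausdorff_accessible/rV_hausdorff.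
Qed.

Lemma zero_set_sub (f : K -> 'rV[R]_n) (r : R) (Z : set K) :
  continuous f -> zero_sets f r Z -> Z `<=` sublevel f r.
Proof.
move=> cf [g [cg fg ->]] x /= gx0; have := dist_ub x cf cg.
by rewrite gx0 subr0 => h; exact: le_trans fg.
Qed.

Section Fixed.
Variables (f : K -> 'rV[R]_n) (hf : continuous f) (r : R).
Variables (B : set K) (hB : closed B).

Definition X_ch : compHaus :=
  subspace_ch (@ch_hausdorff K) (closed_compact (sublevel_closed r hf)).

Definition X_pair (D : set K) (hD : closed D) : cpair :=
  subpair (@ch_hausdorff K) (closed_compact (sublevel_closed r hf)) hD.

Definition well_group (H : homology R) (q : int) : set (H q (X_pair hB)) :=
  [set x | forall (Z : set K) (hZ : zero_sets f r Z),
     exists z : H q (subpair (@ch_hausdorff K) (zero_set_compact hZ) hB),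
       hmap H (subpair_incl (@ch_hausdorff K) (zero_set_compact hZ)
                 (closed_compact (sublevel_closed r hf)) hB hB
                 (zero_set_sub hf hZ) (@subset_refl _ B)) z = x].

Let f_in (x : X_ch) : sublevel idfun r (f (set_val x)) :=
  set_valK (Y := sublevel f r) x.

Definition f_pair : cmap (X_pair (level_closed r hf)) (ball_pair r) :=
  @CMap (X_pair (level_closed r hf)) (ball_pair r) (corestrict f_in)
    (corestrict_continuous (gY := f_in)
       (comp_continuous (@set_val_continuous K (sublevel f r)) hf))
    (fun=> id).

Definition first_obstruction (C : cohomology R) (xi : C n%:Z (ball_pair r)) :
    C n%:Z (X_pair (level_closed r hf)) :=
  comap C f_pair xi.

Definition cap_image (H : homology R) (C : cohomology R) (cp : cap_product H C)
    (k : int) (phi : C n%:Z (X_pair (level_closed r hf))) :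
    set (H (k - n%:Z) (X_pair hB)) :=
  [set cap_op cp (phi : C n%:Z (CPair (@sub_closed (X_pair (level_closed r hf)))))
         b | b in [set: H k (CPair (closedU
                     (@sub_closed (X_pair (level_closed r hf)))
                     (@sub_closed (X_pair hB))))]].

End Fixed.

End WellGroup.

Arguments fundamental {R n N C r} xi.
Arguments first_obstruction {R n N K f} hf {r C} xi.
Arguments well_group {R n} N {K f} hf r {B} hB H q.
Arguments cap_image {R n N K f hf r B} hB {H C} cp k phi.

Definition subgroup (G : zmodType) (S : set G) : Prop :=
  S 0 /\ forall x y, S x -> S y -> S (x - y).

Definition subgroup_of (G : zmodType) (S U : set G) : Prop :=
  [/\ subgroup S, subgroup U & S `<=` U].

(* Main.v *)
Require Import Defs.
From mathcomp Require Import all_boot all_order all_algebra.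
From mathcomp Require Import all_classical all_reals all_analysis.
From mathcomp Require Import ring lra.
Import Order.TTheory GRing.Theory Num.Theory.
Import numFieldNormedType.Exports.
Local Open Scope classical_set_scope.
Local Open Scope ring_scope.

(** Let [g] be within [r] of [f], with zero set [Z], and let [f_i = f + i g],
    [X_i = {N (f_i) <= r}], [A_i = {N (f_i) = r}].  As [N (f - g) <= r] and
    [f_i] is a convex combination of [f_(i+1)] and [f - g], the sets [X_i]
    decrease from [X_0 = X]; a point lying in all of them has [i N(g)] bounded,
    so their intersection is contained in [Z].

    A product [phi_i cap beta], with [phi_i] the obstruction of [f_i] and [beta]
    in [H_k (X_i, A_i U B)], comes from [H (X_(i+1), B)], and even from a product
    of the same kind there ([lift_cap]).  Indeed the segment from [f_i] to
    [f_(i+1)] stays outside the open ball over [A_i], so composing it with the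
    radial map [y |-> y * (r / max r (N y))] is a homotopy of pairs.  Hence
    [phi_i] is the restriction of a class of [X_i] relative to
    [A' = {N (f_(i+1)) >= r}], pulled back by the radial map after [f_(i+1)], and
    by naturality [beta] may be replaced by its image in [H_k (X_i, A' U B)].
    Strong excision identifies this group with
    [H_k (X_(i+1), A_(i+1) U B)], and naturality moves the product to [X_(i+1)].

    Iterating gives a compatible family of classes in [H (X_i, B)] starting at
    the given product, and weak continuity lifts it to the intersection, hence to
    [Z] ([cap_from_zeros]).  Using the whole sequence instead of a single map to
    [g] is what allows [g] to vanish on [A_0]. *)

(** * Maps of pairs *)

Lemma cmap_eq (P Q : cpair) (f g : cmap P Q) : (forall x, f x = g x) -> f = g.
Proof.
case: f g => f cf sf [g cg sg] /= /funext fg; move: cf sf cg sg.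
by rewrite fg => cf sf cg sg; congr CMap; exact: Prop_irrelevance.
Qed.

Lemma hmap_eq {R : realType} (H : homology R) q (P Q : cpair) (f g : cmap P Q)
    (x : H q P) :
  (forall y, f y = g y) -> hmap H f x = hmap H g x.
Proof. by move=> /cmap_eq ->. Qed.

(** Inclusions [(Y, B) -> (Y', B')] where only the trace of [B] on [Y] has to lie
    in [B']: this covers the passage between [(Y, B)] and [(Y, Y `&` B)]. *)
Section Inclusion.
Context {T : topologicalType} (hT : hausdorff_space T).
Context {Y Y' B B' : set T} (hY : compact Y) (hY' : compact Y').
Context (hB : closed B) (hB' : closed B').
Hypotheses (YY' : Y `<=` Y') (BB' : Y `&` B `<=` B').

Let f_in (x : set_type Y) : Y' (set_val x) := YY' _ (set_valK x).

Definition subpair_map : cmap (subpair hT hY hB) (subpair hT hY' hB') :=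
  @CMap (subpair hT hY hB) (subpair hT hY' hB') (corestrict f_in)
    (corestrict_continuous (gY := f_in) (@set_val_continuous T Y))
    (fun x Bx => BB' _ (conj (set_valK x) Bx)).

End Inclusion.

(** * The radial map onto the ball *)

Section Radial.
Context {R : realType} {n : nat} (N : vnorm R n) (r : R).
Hypothesis r_gt0 : 0 < r.

Definition radial (y : 'rV[R]_n) : 'rV[R]_n := (r / Num.max r (N y)) *: y.

Let max_gt0 y : 0 < Num.max r (N y).
Proof. by rewrite lt_max r_gt0. Qed.

Lemma norm_radial y : N (radial y) = r / Num.max r (N y) * N y.
Proof. by rewrite vnormZ ger0_norm// ltW// divr_gt0. Qed.

Lemma radial_ball y : N (radial y) <= r.
Proof.
rewrite norm_radial mulrAC ler_pdivrMr// ler_wpM2l ?(ltW r_gt0)//.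
by rewrite le_max lexx orbT.
Qed.

Lemma radial_id y : N y <= r -> radial y = y.
Proof. by move=> yr; rewrite /radial max_l// divff ?scale1r// gt_eqF. Qed.

Lemma radial_sphere y : r <= N y -> N (radial y) = r.
Proof.
move=> ry; rewrite norm_radial max_r// divfK//.
by rewrite gt_eqF// (lt_le_trans r_gt0).
Qed.

Lemma radial_continuous : continuous radial.
Proof.
have cmax : continuous (fun y => Num.max r (N y) : R).
  by apply: max_fun_continuous; [exact: cst_continuous|exact: vnorm_continuous].
move=> y.
have cscale : r / Num.max r (N z) @[z --> y] --> r / Num.max r (N y).
  have cinv : (Num.max r (N z))^-1 @[z --> y] --> (Num.max r (N y))^-1.
    by apply: (cvgV _ (cmax y)); rewrite gt_eqF.
  exact: (cvgM (cvg_cst r) cinv).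
exact: (cvgZ cscale (@cvg_id _ (nbhs y))).
Qed.

End Radial.

Arguments radial_ball {R n} N {r}.
Arguments radial_id {R n N r}.
Arguments radial_sphere {R n N r}.
Arguments radial_continuous {R n} N {r}.

(** * Moving a cap product to a smaller sublevel set *)

Section ObstructionCap.
Context {R : realType} {H : homology R} {C : cohomology R}.
Context (cp : cap_product H C).
Context {n : nat} {N : vnorm R n} {K : compHaus} {B : set K} (hB : closed B).
Context {f : K -> 'rV[R]_n} (hf : continuous f) {r : R}.

Let XA := X_pair N hf r (level_closed (N := N) (r := r) hf).

Definition level_union_pair : cpair :=
  CPair (closedU (@sub_closed XA) (@sub_closed (X_pair N hf r hB))).

Definition obstruction_cap (xi : C n%:Z (ball_pair N r)) {k}
    (b : H k level_union_pair) : H (k - n%:Z) (X_pair N hf r hB) :=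
  cap_op cp (first_obstruction hf xi : C _ (CPair (@sub_closed XA))) b.

End ObstructionCap.

(** Two maps [f0], [f1] such that the segment from [f0] to [f1] does not enter the
    open ball at the points where [f0] is on the sphere. *)
Section Step.
Context {R : realType} {H : homology R} {C : cohomology R}.
Context (cp : cap_product H C) (H_exc : strong_excision H).
Context {n : nat} {N : vnorm R n} {K : compHaus} {B : set K} (hB : closed B).
Context {r : R} (r_gt0 : 0 < r).
Context {f0 f1 : K -> 'rV[R]_n} (hf0 : continuous f0) (hf1 : continuous f1).
Hypothesis sub10 : sublevel N f1 r `<=` sublevel N f0 r.
Hypothesis away0 : forall x t, N (f0 x) = r -> 0 <= t <= 1 ->
  r <= N (f0 x + t *: (f1 x - f0 x)).

Let X0 := X_ch N hf0 r.
Let A0 := @sub_closed (X_pair N hf0 r (level_closed (N := N) (r := r) hf0)).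
Let A1 := @sub_closed (X_pair N hf1 r (level_closed (N := N) (r := r) hf1)).
Let B0 := @sub_closed (X_pair N hf0 r hB).
Let B1 := @sub_closed (X_pair N hf1 r hB).

Definition outer : set X0 := [set x | r <= N (f1 (set_val x))].

Lemma outer_closed : closed outer.
Proof.
apply: (@preimage_closed _ _ (fun x : X0 => N (f1 (set_val x))) [set y | r <= y]).
  move=> x _.
  exact: (comp_continuous (@set_val_continuous K (sublevel N f0 r))
    (vnorm_comp_continuous (N := N) hf1)).
exact: closed_ge.
Qed.

Lemma level_outer : sub (CPair A0) `<=` outer.
Proof.
move=> x /= fx; have := @away0 (set_val x) 1 fx.
by rewrite scale1r addrC subrK lexx ler01; exact.
Qed.

Definition incl10 : cmap (CPair B1) (CPair B0) :=
  subpair_map (@ch_hausdorff K)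
    (closed_compact (sublevel_closed (N := N) (r := r) hf1))
    (closed_compact (sublevel_closed (N := N) (r := r) hf0)) hB hB
    sub10 (@subIsetr _ _ _).

(* Three versions of the inclusion of [X1] in [X0], as the naturality of the cap
   product requires: [incl10], [incl_outer] and [incl_outerU]. *)
Let incl_outer : cmap (CPair A1) (CPair outer_closed).
Proof.
apply: (@CMap (CPair A1) (CPair outer_closed) incl10).
  exact: (@cmap_continuous _ _ incl10).
by move=> x /= fx; rewrite /outer /= fx.
Defined.

Let incl_outerU : cmap (CPair (closedU A1 B1)) (CPair (closedU outer_closed B0)).
Proof.
apply: (@CMap (CPair (closedU A1 B1)) (CPair (closedU outer_closed B0)) incl10).
  exact: (@cmap_continuous _ _ incl10).
move=> x [/= fx|/= Bx]; last by right.
by left; rewrite /outer /= fx.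
Defined.

(* [widen], [widenU] and the identity of [(X0, B)] are one map of [X0]. *)
Let widen : cmap (CPair A0) (CPair outer_closed) :=
  @CMap (CPair A0) (CPair outer_closed) idfun (@id_continuous X0) level_outer.

Let widenU : cmap (CPair (closedU A0 B0)) (CPair (closedU outer_closed B0)) :=
  @CMap (CPair (closedU A0 B0)) (CPair (closedU outer_closed B0))
    idfun (@id_continuous X0) (setSU level_outer).

Let incl10_sub x : sub (CPair (closedU outer_closed B0)) (incl10 x) ->
  sub (CPair (closedU A1 B1)) x.
Proof.
move=> [/= ox|]; [left|by right].
by apply/eqP; rewrite eq_le ox (set_valK (Y := sublevel N f1 r) x).
Qed.

Let incl10_onto y : ~ outer y -> exists x, incl10 x = y.
Proof.
move=> /negP; rewrite -ltNge => /ltW y1.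
by exists (exist _ (set_val y) (mem_set y1)); exact: val_inj.
Qed.

(** The open part of the small pair, where [f1] is inside the ball and [B] is
    avoided, is the same subspace of [K] as the open part of the large one. *)
Lemma excision_bij k : bijective (hmap H incl_outerU : H k _ -> H k _).
Proof.
apply: H_exc; split.
- split=> [x nx /incl10_sub //|x y _ _ /(congr1 set_val) xy|y ny].
    exact: val_inj.
  have [|x xy] := incl10_onto y; first by move=> oy; apply: ny; left.
  exists x => // nx; apply: ny; rewrite -xy; exact: (cmap_sub incl_outerU nx).
- exact: continuous_subspaceT (@cmap_continuous _ _ incl10).
- move=> U [V oV VU].
  exists (set_val @^-1` V); first by exists V.
  apply/seteqP; split=> y.
    move=> [x [nx Ux] <-]; split; first by move/incl10_sub.
    by move: Ux; rewrite -VU.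
  move=> [ny Vy].
  have [|x xy] := incl10_onto y; first by move=> oy; apply: ny; left.
  exists x => //; split; last by rewrite -VU; move: Vy; rewrite -xy.
  by move=> nx; apply: ny; rewrite -xy; exact: (cmap_sub incl_outerU nx).
Qed.

Let radial_in (h : X0 -> 'rV[R]_n) (x : X0) :
  sublevel N idfun r (radial N r (h x)) := radial_ball N r_gt0 (h x).

Let clamp1 : cmap (CPair outer_closed) (ball_pair N r).
Proof.
apply: (@CMap (CPair outer_closed) (ball_pair N r)
  (corestrict (radial_in (f1 \o set_val)))).
  apply: corestrict_continuous; apply: comp_continuous (radial_continuous N r_gt0).
  exact: comp_continuous (@set_val_continuous K _) hf1.
by move=> x ox; exact: radial_sphere.
Defined.

Lemma clamp1_incl : cmap_comp clamp1 incl_outer = f_pair N hf1 r.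
Proof.
apply: cmap_eq => x; apply: val_inj => /=.
by apply: radial_id => //; exact: (set_valK (Y := sublevel N f1 r) x).
Qed.

Let segment (p : X0 * R) : 'rV[R]_n :=
  f0 (set_val p.1) + p.2 *: (f1 (set_val p.1) - f0 (set_val p.1)).

Let segment_continuous : continuous segment.
Proof.
have cpr (h : K -> 'rV[R]_n) (ch : continuous h) :
    continuous (fun p : X0 * R => h (set_val p.1)).
  apply: (@comp_continuous _ _ _ (fun p : X0 * R => set_val p.1)) => //.
  apply: (@comp_continuous _ _ _ (fst : X0 * R -> X0)) => [q|].
    exact: cvg_fst.
  exact: set_val_continuous.
move=> p; apply: cvgD; first exact: cpr.
apply: cvgZ; first exact: cvg_snd.
by apply: cvgB; exact: cpr.
Qed.

(** Straight-line homotopy followed by the radial map: over [A0] the segment stays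
    outside the open ball, so that the homotopy remains on the sphere. *)
Lemma clamp1_widen : homotopic R (f_pair N hf0 r) (cmap_comp clamp1 widen).
Proof.
pose F (p : X0 * R) : ball_pair N r :=
  corestrict (fun p => radial_ball N r_gt0 (segment p)
    : sublevel N idfun r _) p.
exists F; split.
- apply: continuous_subspaceT => p.
  exact: (@corestrict_continuous _ _ (sublevel N idfun r) (radial N r \o segment)
    (fun p => radial_ball N r_gt0 (segment p))
    (comp_continuous segment_continuous (radial_continuous N r_gt0)) p).
- move=> x; apply: val_inj; rewrite /= /segment scale0r addr0.
  by apply: radial_id => //; exact: (set_valK (Y := sublevel N f0 r) x).
- by move=> x; apply: val_inj; rewrite /= /segment scale1r addrC subrK.
- by move=> x t fx t01; apply: radial_sphere => //; exact: away0.
Qed.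

(** [b1] is the excision of the image of [b0]; the two obstructions are
    restrictions of one class relative to [outer], so naturality applies to both
    products. *)
Lemma lift_cap (xi : C n%:Z (ball_pair N r)) {k}
    (b0 : H k (level_union_pair hB hf0)) :
  exists b1 : H k (level_union_pair hB hf1),
    hmap H incl10 (obstruction_cap cp hB hf1 xi b1) =
    obstruction_cap cp hB hf0 xi b0.
Proof.
have [inv _ incl_inv] := excision_bij k.
exists (inv (hmap H widenU b0)).
rewrite /obstruction_cap /first_obstruction -clamp1_incl comap_comp.
rewrite (cap_natural cp (fA := incl_outer) (fAB := incl_outerU))// incl_inv.
rewrite (comap_homotopy clamp1_widen) comap_comp -[RHS](hmap_id (h := H)).
by rewrite (cap_natural cp (fA := widen) (fB := cmap_id (CPair B0))
  (fAB := widenU)).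
Qed.

End Step.

(** * The half-line from [y] in the direction [z] *)

Section Line.
Context {R : realType} {n : nat} (N : vnorm R n) {r : R} {y z : 'rV[R]_n}.
Hypothesis yz : N (y - z) <= r.

(** Convexity of [N] along the line: the value [u = -1] of the parameter gives the
    point [y - z], and [u] lies between [-1] and [v]. *)
Lemma norm_line u v : 0 <= u -> u <= v ->
  (1 + v) * N (y + u *: z) <= (1 + u) * N (y + v *: z) + (v - u) * r.
Proof.
move=> u0 uv; have v0 := le_trans u0 uv.
have -> : (1 + v) * N (y + u *: z) = N ((1 + v) *: (y + u *: z)).
  by rewrite vnormZ ger0_norm// addr_ge0.
have -> : (1 + v) *: (y + u *: z) =
    (1 + u) *: (y + v *: z) + (v - u) *: (y - z).
  by apply/rowP => j; rewrite !mxE; ring.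
apply: (le_trans (vnormD N _ _)); rewrite !vnormZ.
rewrite (ger0_norm (x := 1 + u)) ?addr_ge0// (ger0_norm (x := v - u)) ?subr_ge0//.
by rewrite lerD2l ler_wpM2l// subr_ge0.
Qed.

Lemma line_nested u v : 0 <= u -> u <= v ->
  N (y + v *: z) <= r -> N (y + u *: z) <= r.
Proof.
move=> u0 uv vr; have v1 : 0 < 1 + v by rewrite ltr_wpDr// (le_trans u0).
rewrite -(ler_pM2l v1) (le_trans (norm_line _ _ u0 uv))//.
have : (1 + u) * N (y + v *: z) <= (1 + u) * r by rewrite ler_wpM2l// addr_ge0.
by lra.
Qed.

Lemma line_outward u v : 0 <= u -> u <= v ->
  N (y + u *: z) = r -> r <= N (y + v *: z).
Proof.
move=> u0 uv ur; have := norm_line _ _ u0 uv; rewrite ur => h.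
have u1 : 0 < 1 + u by rewrite ltr_wpDr.
by rewrite -(ler_pM2l u1); lra.
Qed.

End Line.

Lemma line_bounded {R : realType} {n : nat} (N : vnorm R n) (r : R) y z :
  (forall i, N (y + i%:R *: z) <= r) -> z = 0.
Proof.
move=> h; apply: (vnorm_eq0 (v := N)); apply/eqP/contraT => z0.
have zp : 0 < N z by rewrite lt_neqAle vnorm_ge0 andbT eq_sym.
pose i := Num.bound (2 * r / N z).
have r0 : 0 <= r by apply: le_trans (h 0%N); exact: vnorm_ge0.
have hi : 2 * r < i%:R * N z.
  by rewrite -ltr_pdivrMr// archi_boundP// divr_ge0 ?vnorm_ge0// mulr_ge0.
have : i%:R * N z <= r + r.
  have -> : i%:R * N z = N (i%:R *: z) by rewrite vnormZ ger0_norm.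
  have -> : i%:R *: z = (y + i%:R *: z) + - (y + 0%:R *: z).
    by rewrite scale0r addr0 addrC addKr.
  by rewrite (le_trans (vnormD N _ _))// vnormN lerD.
by lra.
Qed.

(** * Subgroups *)

Lemma cap_image_subgroup {R : realType} {H : homology R} {C : cohomology R}
    (cp : cap_product H C) (n : nat) (N : vnorm R n) (K : compHaus)
    (B : set K) (hB : closed B) (f : K -> 'rV[R]_n) (hf : continuous f) (r : R)
    k phi :
  subgroup (@cap_image _ _ N K f hf r _ hB _ _ cp k phi).
Proof.
split; first by exists 0 => //; rewrite -(subrr 0) capBr subrr.
by move=> _ _ [b _ <-] [b' _ <-]; exists (b - b') => //; rewrite capBr.
Qed.

Lemma well_group_subgroup {R : realType} (H : homology R) (n : nat)
    (N : vnorm R n) (K : compHaus) (B : set K) (hB : closed B)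
    (f : K -> 'rV[R]_n) (hf : continuous f) (r : R) q :
  subgroup (well_group N hf r hB H q).
Proof.
split=> [Z hZ|x y hx hy Z hZ]; first by exists 0; rewrite raddf0.
have [z <-] := hx Z hZ; have [w <-] := hy Z hZ.
by exists (z - w); rewrite raddfB.
Qed.

(** * Lifting a cap product to a zero set *)

Section CapInWellGroup.
Context {R : realType} {H : homology R} {C : cohomology R}.
Context (cp : cap_product H C).
Context (H_weak : weakly_continuous H) (H_exc : strong_excision H).
Context {n : nat} {N : vnorm R n} {K : compHaus} {B : set K} (hB : closed B).
Context {f : K -> 'rV[R]_n} (hf : continuous f) {r : R} (r_gt0 : 0 < r).
Context (xi : C n%:Z (ball_pair N r)).
Context {g : K -> 'rV[R]_n} (hg : continuous g) (fg : dist N f g <= r).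

(** Iteration, rather than [f + i g], makes the first term [f] itself, so that the
    lifting starts from the groups of [X], up to a proof of continuity. *)
Definition steps (i : nat) : K -> 'rV[R]_n := iter i (fun h x => h x + g x) f.

Lemma stepsE i x : steps i x = f x + i%:R *: g x.
Proof.
elim: i => [|i IHi]; first by rewrite scale0r addr0.
by rewrite /= IHi -natr1 scalerDl scale1r addrA.
Qed.

Lemma steps_continuous i : continuous (steps i).
Proof.
elim: i => [|i IHi]; first exact: hf.
by move=> x; apply: cvgD; [exact: IHi|exact: hg].
Qed.

Let fgx x : N (f x - g x) <= r := le_trans (dist_ub N x hf hg) fg.

Lemma steps_nested i : sublevel N (steps i.+1) r `<=` sublevel N (steps i) r.
Proof.
move=> x; rewrite /sublevel /mkset !stepsE.
by apply: (line_nested _ (fgx x)); rewrite ?ler_nat.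
Qed.

Lemma steps_outward i x t : N (steps i x) = r -> 0 <= t <= 1 ->
  r <= N (steps i x + t *: (steps i.+1 x - steps i x)).
Proof.
rewrite /= addrAC subrr add0r stepsE -addrA -scalerDl => fx /andP[t0 _].
by move: fx; apply: (line_outward _ (fgx x)); rewrite ?lerDl.
Qed.

Let sub_compact i := closed_compact (sublevel_closed (N := N) (r := r)
  (@steps_continuous i)).

Let trace i : set K := B `&` sublevel N (steps i) r.

Let trace_closed i : closed (trace i).
Proof. by apply: closedI => //; exact: sublevel_closed (@steps_continuous i). Qed.

Let trace_sub i : trace i `<=` sublevel N (steps i) r := @subIsetr _ _ _.

Let trace_nested i : trace i.+1 `<=` trace i.
Proof. by apply: setIS; exact: steps_nested. Qed.

Lemma cap_from_zeros {k} (b : H k (level_union_pair hB hf))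
    {Z : set K} (hZ : compact Z)
    (gZ : g @^-1` [set 0] `<=` Z) (ZX : Z `<=` sublevel N f r) :
  exists z, hmap H (subpair_map (@ch_hausdorff K) hZ
    (closed_compact (sublevel_closed (N := N) (r := r) hf)) hB hB
    ZX (@subIsetr _ _ _)) z =
    obstruction_cap cp hB hf xi b.
Proof.
rewrite (Prop_irrelevance hf (@steps_continuous 0)) in b *.
pose G i : zmodType :=
  H k (level_union_pair (N := N) (r := r) hB (@steps_continuous i)).
pose cap i (c : G i) := obstruction_cap cp hB (@steps_continuous i) xi c.
have [bs [bs0 bsS]] : exists bs : forall i, G i, bs 0%N = b /\
    forall i, hmap H (incl10 hB (@steps_continuous i) (@steps_continuous i.+1)
      (@steps_nested i)) (cap _ (bs i.+1)) = cap _ (bs i).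
  pose next i (c : G i) := cid (lift_cap cp H_exc hB r_gt0
    (@steps_continuous i) (@steps_continuous i.+1) (@steps_nested i)
    (@steps_outward i) xi c).
  exists (nat_rect G b (fun i c => sval (next i c))); split=> // i.
  exact: svalP (next i _).
(* Weak continuity is about pairs [(Y, B)] with [B] inside [Y]; [to_trace] and
   [from_trace] are the identity of [X_i], seen between [(X_i, B)] and
   [(X_i, B `&` X_i)]. *)
pose to_trace i := subpair_map (@ch_hausdorff K) (sub_compact i) (sub_compact i)
  hB (trace_closed i) (@subset_refl _ _) (fun x p => conj p.2 p.1).
have [|y hy] := H_weak _ (@ch_hausdorff K) _ _ sub_compact trace_closed
  steps_nested trace_nested trace_sub (k - n%:Z)
  (fun i => hmap H (to_trace i) (cap _ (bs i))).
  move=> i; rewrite -(bsS i) -!hmap_comp; apply: hmap_eq => x.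
  exact: val_inj.
have capZ : \bigcap_i sublevel N (steps i) r `<=` Z.
  move=> x hx; apply: gZ; apply: (line_bounded N r (f x)) => i.
  by rewrite -stepsE; exact: hx.
exists (hmap H (subpair_map (@ch_hausdorff K)
  (bigcap_compact (@ch_hausdorff K) sub_compact) hZ (bigcap_closed trace_closed)
  hB capZ (fun x p => (p.2 0%N I).1)) y).
pose from_trace := subpair_map (@ch_hausdorff K) (sub_compact 0) (sub_compact 0)
  (trace_closed 0) hB (@subset_refl _ _) (fun x p => p.2.1).
transitivity (hmap H from_trace (hmap H (to_trace 0%N) (cap _ (bs 0%N)))).
  rewrite -hy -!hmap_comp; apply: hmap_eq => x.
  exact: val_inj.
rewrite bs0 -hmap_comp -[RHS](hmap_id (h := H)); apply: hmap_eq => x.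
exact: val_inj.
Qed.

End CapInWellGroup.

Theorem theorem1 (R : realType)
    (H : homology R) (C : cohomology R) (cp : cap_product H C)
    (H_weak : weakly_continuous H) (H_exc : strong_excision H)
    (cp_simp : simplicial_cap cp)
    (n : nat) (N : vnorm R n)
    (K : compHaus) (B : set K) (hB : closed B)
    (f : K -> 'rV[R]_n) (hf : continuous f) (r : R) (r_gt0 : 0 < r)
    (xi : C n%:Z (ball_pair N r)) (xi_fund : fundamental xi)
    (k : int) (le_nk : n%:Z <= k) :
  subgroup_of (cap_image hB cp k (first_obstruction hf xi))
    (well_group N hf r hB H (k - n%:Z)).
Proof.
split; [exact: cap_image_subgroup|exact: well_group_subgroup|].
move=> _ [b _ <-] Z hZ; have [g [hg fg gZ]] := hZ.
have gsub : g @^-1` [set 0] `<=` Z by rewrite gZ.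
have [z hz] := cap_from_zeros cp H_weak H_exc hB hf r_gt0 xi hg fg b
  (zero_set_compact hZ) gsub (zero_set_sub hf hZ).
exists z; transitivity (obstruction_cap cp hB hf xi b); last by [].
by rewrite -hz; apply: hmap_eq => x; exact: val_inj.
Qed.
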